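(* Let $n\ge2$ and let $a=\sum_{\alpha\in I(\mathbb{KP}_n)}a_\alpha\chi_\alpha\in C(\mathbb{KP}_n)$ (with $a_\alpha\in\mathbb C$) be such that $\mathcal F(a)$ is a state. For any natural integer $k$, $$\left\lVert\mathcal F(a)^{\star k}-\int_{\mathbb{KP}_n}\right\rVert_{QTV}\le\sqrt{\frac14\sum_{\substack{\alpha\in I(\mathbb{KP}_n)\\ \alpha\ne\rho_0^+,\ d_\alpha=1}}|a_\alpha|^{2k}+\frac1{4^k}\sum_{\substack{\alpha\in I(\mathbb{KP}_n)\\ d_\alpha=2}}|a_\alpha|^{2k}}.$$
   Context: Sekine quantum group $\mathbb{KP}_n$ ($n\ge2$). Put $\eta=e^{2\imath\pi/n}$; all indices are taken modulo $n$. $C(\mathbb{KP}_n)=\bigoplus_{i,j\in\mathbb Z_n}\mathbb C e_{(i,j)}\oplus M_n(\mathbb C)$ as a $*$-algebra, where the $e_{(i,j)}$ are the units of the one-dimensional summands and $E_{i,j}$ ($1\le i,j\le n$) are matrix units of $M_n(\mathbb C)$. The coproduct is $\Delta(e_{(i,j)})=\sum_{s,t\in\mathbb Z_n}e_{(s,t)}\otimes e_{(i-s,j-t)}+\frac1n\sum_{m,r=1}^n\eta^{i(m-r)}E_{m,r}\otimes E_{m+j,r+j}$, $\Delta(E_{i,j})=\sum_{s,t\in\mathbb Z_n}\eta^{s(i-j)}e_{(-s,-t)}\otimes E_{i-t,j-t}+\sum_{s,t\in\mathbb Z_n}\eta^{s(j-i)}E_{i-t,j-t}\otimes e_{(s,t)}$.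 The Haar state is $\int_{\mathbb{KP}_n}\big(\sum x_{(i,j)}e_{(i,j)}+\sum X_{i,j}E_{i,j}\big)=\frac1{2n^2}\big(\sum_{i,j}x_{(i,j)}+n\sum_iX_{i,i}\big)$. For $x\in C(\mathbb{KP}_n)$, $\mathcal F(x)$ is the linear functional $y\mapsto\int_{\mathbb{KP}_n}yx$. The convolution of functionals is $\phi\star\psi=(\phi\otimes\psi)\circ\Delta$, and $\phi^{\star k}$ is the $k$-fold convolution power ($\phi^{\star0}$ being the counit, i.e. the coefficient of $e_{(0,0)}$; $0^0=1$). A state is a positive unital linear functional. $\lVert\phi-\psi\rVert_{QTV}=\sup\{|\phi(p)-\psi(p)|:p\in C(\mathbb{KP}_n)\text{ a projection}\}$. Irreducible representations: $I(\mathbb{KP}_n)$ is the set of (classes of) irreducible representations, $d_\alpha$ is the dimension and $\chi_\alpha$ the character of $\alpha$. It consists of the one-dimensional $\rho_l^\pm=\sum_{i,j}\eta^{il}e_{(i,j)}\pm\sum_{m=1}^nE_{m,m+l}$ ($l\in\mathbb Z_n$; $\rho_0^+$ is the unit), the two-dimensional $\mathfrak X^{u,v}$ ($u\in\mathbb Z_n$, $1\le v\le\lfloor\frac{n-1}2\rfloor$) with characters $2\sum_{s,t\in\mathbb Z_n}\eta^{su}\cos(\frac{2tv\pi}n)e_{(s,t)}$, and, if $n$ is even, also the one-dimensional $\sigma_l^\pm=\sum_{i,j}(-1)^j\eta^{il}e_{(i,j)}\pm\sum_{m=1}^n(-1)^mE_{m,m+l}$ ($l\in\mathbb Z_n$).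 *)

(* Defs.v *)
From HB Require Import structures.
From mathcomp Require Import all_boot all_order all_algebra.
From mathcomp Require Import complex.
From mathcomp Require Import all_classical all_reals all_analysis.

Set Implicit Arguments.
Unset Strict Implicit.
Unset Printing Implicit Defensive.

Import Order.TTheory GRing.Theory Num.Theory.

Local Open Scope complex_scope.
Local Open Scope ring_scope.

Export ComplexField.Normc.

(* Throughout, n is meant to be at least 2: 'Z_n denotes Z/2Z when n < 2.
   Indices 1, ..., n are read in Z/nZ, the residue 0 standing for n. *)

(* The *-algebra C(KP_n), the sum of n^2 copies of C and of M_n(C).  Its unit,
   product and scaling are those of finite functions, matrices and pairs. *)
Notation sekine R n :=
  ({ffun 'Z_n * 'Z_n -> R[i]} * 'M[R[i]]_((Zp_trunc n).+2))%type.

Section Algebra.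
Variables (R : realType) (n : nat).
Local Notation C := R[i].
Local Notation A := (sekine R n).

Definition e_ (i j : 'Z_n) : A := ([ffun p => (p == (i, j))%:R], 0).
Definition E_ (i j : 'Z_n) : A := (0, delta_mx i j).

Definition star (x : A) : A :=
  ([ffun p => (x.1 p)^*], \matrix_(i, j) (x.2 j i)^*).

Definition projection (p : A) := p * p = p /\ star p = p.

Definition state (phi : A -> C) :=
  [/\ scalar phi, forall x, 0 <= phi (star x * x) & phi 1 = 1].

(* The tensor square, as coordinates on pairs of vectors of the standard basis:
   inl (i, j) is the index of e_ i j and inr (i, j) that of E_ i j. *)
Definition basis_index : finType := (('Z_n * 'Z_n) + ('Z_n * 'Z_n))%type.

Definition basis (b : basis_index) : A :=
  match b with inl p => e_ p.1 p.2 | inr p => E_ p.1 p.2 end.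

Definition coord (x : A) (b : basis_index) : C :=
  match b with inl p => x.1 p | inr p => x.2 p.1 p.2 end.

Definition tensor_square := {ffun basis_index * basis_index -> C}.

Definition tensor (x y : A) : tensor_square :=
  [ffun bc => coord x bc.1 * coord y bc.2].

Definition tensor_functional (phi psi : A -> C) (T : tensor_square) : C :=
  \sum_(bc : basis_index * basis_index)
    T bc * (phi (basis bc.1) * psi (basis bc.2)).

Lemma basis_coord (x : A) : x = \sum_b coord x b *: basis b.
Proof.
rewrite big_sumType [LHS]surjective_pairing [RHS]surjective_pairing /=.
congr pair.
- rewrite !raddf_sum /= [X in _ + X]big1 ?addr0; last first.
    by move=> p _; rewrite scaler0.
  apply/ffunP => p; rewrite sum_ffunE (bigD1 p) //= big1 ?addr0.
    by rewrite !ffunE -surjective_pairing eqxx [RHS]mulr1.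
  move=> q neq_qp; rewrite !ffunE -surjective_pairing eq_sym (negPf neq_qp).
  exact: mulr0.
- rewrite !raddf_sum /= [X in X + _]big1 ?add0r; last first.
    by move=> p _; rewrite scaler0.
  rewrite [LHS]matrix_sum_delta pair_big /=; exact: eq_bigr.
Qed.

Lemma tensor_functional_tensor (phi psi : A -> C) (x y : A) :
  scalar phi -> scalar psi ->
  tensor_functional phi psi (tensor x y) = phi x * psi y.
Proof.
move=> phi_lin psi_lin.
have lin (f : A -> C) z : scalar f -> f z = \sum_b coord z b * f (basis b).
  move=> f_lin; pose fM := GRing.isLinear.Build C A C *%R f f_lin.
  pose g : {scalar A} := HB.pack f fM.
  rewrite [in LHS](basis_coord z) -[f _]/(g _) raddf_sum.
  by apply: eq_bigr => b _; exact: (linearZ_LR g).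
rewrite (lin _ x phi_lin) (lin _ y psi_lin) big_distrlr pair_big /=.
by apply: eq_bigr => bc _; rewrite ffunE mulrACA.
Qed.

(* eta^z, which is well defined for an exponent z in Z/nZ *)
Definition etaX (z : 'Z_n) : C :=
  (cos (2 * pi / n%:R) +i* sin (2 * pi / n%:R)) ^+ z.

Definition coproduct_e (i j : 'Z_n) : tensor_square :=
  \sum_(s : 'Z_n) \sum_(t : 'Z_n) tensor (e_ s t) (e_ (i - s) (j - t))
  + n%:R^-1 *: \sum_(m : 'Z_n) \sum_(r : 'Z_n)
      etaX (i * (m - r)) *: tensor (E_ m r) (E_ (m + j) (r + j)).

Definition coproduct_E (i j : 'Z_n) : tensor_square :=
  \sum_(s : 'Z_n) \sum_(t : 'Z_n)
      etaX (s * (i - j)) *: tensor (e_ (- s) (- t)) (E_ (i - t) (j - t))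
  + \sum_(s : 'Z_n) \sum_(t : 'Z_n)
      etaX (s * (j - i)) *: tensor (E_ (i - t) (j - t)) (e_ s t).

Definition coproduct (x : A) : tensor_square :=
  \sum_(i : 'Z_n) \sum_(j : 'Z_n) x.1 (i, j) *: coproduct_e i j
  + \sum_(i : 'Z_n) \sum_(j : 'Z_n) x.2 i j *: coproduct_E i j.

Definition counit (x : A) : C := x.1 (0, 0).

Definition haar (x : A) : C :=
  (2 * n%:R ^+ 2)^-1
  * (\sum_(i : 'Z_n) \sum_(j : 'Z_n) x.1 (i, j)
     + n%:R * \sum_(i : 'Z_n) x.2 i i).

Definition fourier (x : A) : A -> C := fun y => haar (y * x).

Definition convolution (phi psi : A -> C) : A -> C :=
  fun x => tensor_functional phi psi (coproduct x).

Fixpoint conv_pow (phi : A -> C) (k : nat) : A -> C :=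
  if k is k'.+1 then convolution (conv_pow phi k') phi else counit.

(* The supremum is taken in the extended reals, where it always exists. *)
Definition qtv_dist (phi psi : A -> C) : \bar R :=
  ereal_sup [set (normc (phi p - psi p))%:E | p in projection].

End Algebra.

(* Labels of the classes of irreducible representations: Rho l true is rho_l^+,
   Rho l false is rho_l^-, and likewise for Sigma, which needs n to be even. *)
Inductive irrep (n : nat) : Type :=
| Rho (l : 'Z_n) (plus : bool)
| Xrep (u : 'Z_n) (v : {v : 'I_n | 1 <= v <= (n - 1)./2}%N)
| Sigma (n_even : ~~ odd n) (l : 'Z_n) (plus : bool).

Section Irrep.
Variable n : nat.

Definition irrep_sum : finType :=
  (('Z_n * bool + 'Z_n * {v : 'I_n | 1 <= v <= (n - 1)./2}%N)
   + {_ : unit | ~~ odd n} * ('Z_n * bool))%type.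

Definition irrep_code (a : irrep n) : irrep_sum :=
  match a with
  | Rho l b => inl (inl (l, b))
  | Xrep u v => inl (inr (u, v))
  | Sigma h l b => inr (Sub tt h, (l, b))
  end.

Definition irrep_decode (c : irrep_sum) : irrep n :=
  match c with
  | inl (inl (l, b)) => Rho l b
  | inl (inr (u, v)) => Xrep u v
  | inr (h, (l, b)) => Sigma (valP h) l b
  end.

Lemma irrep_codeK : cancel irrep_code irrep_decode.
Proof. by case=> // h l b; congr Sigma; exact: bool_irrelevance. Qed.

HB.instance Definition _ := Equality.copy (irrep n) (can_type irrep_codeK).
HB.instance Definition _ := Choice.copy (irrep n) (can_type irrep_codeK).
HB.instance Definition _ := Countable.copy (irrep n) (can_type irrep_codeK).
HB.instance Definition _ := Finite.copy (irrep n) (can_type irrep_codeK).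

Definition trivial_irrep : irrep n := Rho 0 true.

Definition irrep_dim (a : irrep n) : nat := if a is Xrep _ _ then 2 else 1.

Definition character (R : realType) (a : irrep n) : sekine R n :=
  match a with
  | Rho l plus =>
      \sum_(i : 'Z_n) \sum_(j : 'Z_n) etaX R (i * l) *: e_ R i j
      + ((if plus then 1 else -1) : R[i]) *: \sum_(m : 'Z_n) E_ R m (m + l)
  | Xrep u v =>
      (2 : R[i]) *: \sum_(s : 'Z_n) \sum_(t : 'Z_n)
        (etaX R (s * u)
         * (cos (2 * (t : nat)%:R * (val v : nat)%:R * pi / n%:R))%:C)
        *: e_ R s t
  | Sigma _ l plus =>
      \sum_(i : 'Z_n) \sum_(j : 'Z_n)
        ((-1) ^+ (j : nat) * etaX R (i * l)) *: e_ R i j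
      + ((if plus then 1 else -1) : R[i]) *: \sum_(m : 'Z_n)
          (((-1) ^+ (m : nat)) : R[i]) *: E_ R m (m + l)
  end.

End Irrep.

(* Main.v *)
(* For u, v in Z/nZ put w_{u,v} = sum_{s,t} eta^(su+tv) e_(s,t) and
   z_{u,v} = sum_i eta^(iv) E_{i,i+u}.  Up to the factor sqrt 2 these 2n^2
   elements form an orthonormal basis of L^2, and the coproduct is
     Delta(w_{u,v}) = w_{u,v} (x) w_{u,v} + z_{u,-v} (x) z_{u,v},
     Delta(z_{u,v}) = w_{u,-v} (x) z_{u,v} + z_{u,v} (x) w_{u,v}.
   Hence a functional that is invariant under v |-> -v, such as phi = F(a), has
   phi^{*k}(w + z) = phi(w + z)^k and phi^{*k}(w - z) = phi(w - z)^k, whatever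
   (u, v).  Each phi(w_{u,v} +- z_{u,v}) equals a_alpha / d_alpha for exactly
   one alpha, and alpha arises from at most d_alpha^2 triples (u, v, +-).
   Finally g = phi^{*k} - haar vanishes at 1, so g(p) = g(p - 1/2) for a
   projection p; as 2p - 1 is unitary, p - 1/2 has L^2-norm 1/2, and
   Cauchy-Schwarz and Plancherel bound |g(p)|^2 by
   1/4 sum_{u,v,+-} |g(w_{u,v} +- z_{u,v})|^2. *)
From HB Require Import structures.
Require Import Defs.
From mathcomp Require Import all_boot all_order all_algebra.
From mathcomp Require Import complex.
From mathcomp Require Import all_classical all_reals all_analysis.
From mathcomp Require Import ring lra zify.

Local Open Scope ring_scope.

Set Implicit Arguments.
Unset Strict Implicit.

Import Order.TTheory GRing.Theory Num.Theory.

(** * Powers of eta as characters of Z/nZ *)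

Section RootOfUnity.
Variables (R : realType) (m : nat).
Local Notation n := m.+2.
Local Notation C := R[i].
Local Notation theta := (2 * pi / n%:R : R).
Local Notation eta := ((cos theta +i* sin theta)%C : C).

Lemma de_moivre (x : R) (k : nat) :
  ((cos x +i* sin x)%C : C) ^+ k
  = (cos (k%:R * x) +i* sin (k%:R * x))%C.
Proof.
elim: k => [|k IHk]; first by rewrite expr0 mul0r cos0 sin0.
rewrite exprS IHk mulrSr mulrDl mul1r [_ + x]addrC cosD sinD.
by apply/eqP; rewrite eq_complex /= eqxx /= addrC mulrC [X in _ + X]mulrC eqxx.
Qed.

Lemma eta_order : eta ^+ n = 1.
Proof.
rewrite de_moivre mulrC divfK ?pnatr_eq0 // mulr_natl cos2pi sin2pi.
by apply/eqP; rewrite eq_complex /= !eqxx.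
Qed.

(** The real part is cos(2y) = 1 - 2 sin(y)^2 with y = k pi / n in (0, pi), where the sine is
    positive. *)
Lemma eta_neq1 (k : nat) : (0 < k < n)%N -> eta ^+ k != 1.
Proof.
move=> /andP[k_gt0 lt_kn]; rewrite de_moivre eq_complex /= negb_and.
have -> : k%:R * theta = (k%:R * pi / n%:R : R) *+ 2.
  by rewrite -mulr_natl; ring.
set y := k%:R * pi / n%:R.
have n_gt0 : (0 : R) < n%:R by rewrite ltr0n.
have y_pos : 0 < sin y.
  apply: sin_gt0_pi; apply/andP; split.
    by rewrite divr_gt0 // mulr_gt0 ?pi_gt0 // ltr0n.
  by rewrite ltr_pdivrMr // mulrC ltr_pM2l ?pi_gt0 // ltr_nat.
rewrite cos_mulr2n; apply/orP; left.
have := cos2Dsin2 y; apply: contra_eq_neq => /=; rewrite -mulr_natl => cos_y.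
have : 0 < sin y ^+ 2 by rewrite exprn_gt0.
by lra.
Qed.

Lemma etaX_mod (k : nat) (z : 'Z_n) :
  k = z %[mod n] -> etaX R z = eta ^+ k.
Proof.
by move=> eq_kz; rewrite -(expr_mod k eta_order) eq_kz (expr_mod _ eta_order).
Qed.

Lemma etaX0 : etaX R (0 : 'Z_n) = 1. Proof. by []. Qed.

Lemma etaXD (y z : 'Z_n) : etaX R (y + z) = etaX R y * etaX R z.
Proof. by rewrite (@etaX_mod (y + z)) ?exprD //= modn_mod. Qed.

Lemma etaX_neq0 (z : 'Z_n) : etaX R z != 0.
Proof.
apply/eqP => z0; have /eqP := oner_neq0 C; apply.
by rewrite -etaX0 -(subrr z) etaXD z0 mul0r.
Qed.

Lemma etaXN (z : 'Z_n) : etaX R (- z) = (etaX R z)^-1.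
Proof.
by apply: (mulIf (etaX_neq0 z)); rewrite -etaXD addNr mulVf ?etaX_neq0.
Qed.

Lemma etaX_eq1 (z : 'Z_n) : (etaX R z == 1) = (z == 0).
Proof.
apply/idP/eqP => [|->]; last by rewrite etaX0.
apply: contraTeq => z_neq0; apply: eta_neq1.
by rewrite lt0n z_neq0 ltn_ord.
Qed.

Lemma norm_etaX (z : 'Z_n) : `|etaX R z| = 1.
Proof.
by rewrite normrX normc_def /= cos2Dsin2 sqrtr1 expr1n.
Qed.

Lemma conj_etaX (z : 'Z_n) : Num.conj (etaX R z) = etaX R (- z).
Proof.
apply: (mulfI (etaX_neq0 z)).
by rewrite -normCK norm_etaX expr1n etaXN mulfV ?etaX_neq0.
Qed.

(** For w nonzero, translating z by 1 multiplies the sum by [etaX R w], which is not 1, so the sum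
    vanishes. *)
Lemma sum_etaX (w : 'Z_n) : \sum_(z : 'Z_n) etaX R (z * w) = n%:R * (w == 0)%:R.
Proof.
have [->|w_neq0] := eqVneq w 0.
  under eq_bigr do rewrite mulr0 etaX0.
  by rewrite sumr_const card_ord mulr1.
rewrite mulr0; apply/eqP.
have /negPf w1 : etaX R w != 1 by rewrite etaX_eq1.
rewrite -[_ == 0]orFb -w1 -subr_eq0 -mulf_eq0 mulrBl mul1r subr_eq0; apply/eqP.
rewrite [RHS](reindex_inj (addrI 1)) mulr_sumr /=.
by apply: eq_bigr => z _; rewrite mulrDl mul1r etaXD.
Qed.

(** For v of order 2, [etaX R v] is a square root of 1 other than 1. This turns the signs in the
    [Sigma] characters into powers of eta. *)
Lemma sign_etaX (v : 'Z_n) (k : nat) (z : 'Z_n) :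
  v != 0 -> v + v = 0 -> k = z %[mod n] -> (-1) ^+ k = etaX R (z * v).
Proof.
move=> v_neq0 v2 kz.
have {}v2 : etaX R v = -1.
  have /eqP : etaX R v ^+ 2 = 1 by rewrite expr2 -etaXD v2 etaX0.
  by rewrite sqrf_eq1 etaX_eq1 (negPf v_neq0) => /eqP.
rewrite (@etaX_mod (v * k)) ?exprM.
  by rewrite -[X in _ = X ^+ _]/(etaX R v) v2.
by rewrite /= -modnMmr kz modnMmr modn_mod mulnC.
Qed.

End RootOfUnity.

(** Functionals are bare functions satisfying [scalar]; bundling them here once gives the usual
    morphism rules. *)
Lemma scalar_morph (K : comNzRingType) (U : lmodType K) (f : U -> K) :
  scalar f ->
  [/\ forall x y, f (x + y) = f x + f y,
      forall a x, f (a *: x) = a * f x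
    & forall (I : finType) (G : I -> U), f (\sum_i G i) = \sum_i f (G i)].
Proof.
move=> f_lin.
pose g : {scalar U} := HB.pack f (GRing.isLinear.Build K U K *%R f f_lin).
by split=> [x y|a x|I G]; rewrite -[f]/(g : U -> K);
  [exact: raddfD | exact: (linearZ_LR g) | exact: raddf_sum].
Qed.

(** * Convolution in coordinates and the coproduct of the elements w and z *)

Section Convolution.
Variables (R : realType) (m : nat).
Local Notation n := m.+2.
Local Notation C := R[i].
Local Notation A := (sekine R n).
Implicit Types (phi psi : A -> C) (u v : 'Z_n).

Lemma scalar_coordE phi (x : A) : scalar phi ->
  phi x = \sum_(i : 'Z_n) \sum_(j : 'Z_n) x.1 (i, j) * phi (e_ R i j)
          + \sum_(i : 'Z_n) \sum_(j : 'Z_n) x.2 i j * phi (E_ R i j).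
Proof.
move=> /scalar_morph[phiD phiZ phi_sum].
rewrite [in LHS](basis_coord x) phi_sum big_sumType /= !pair_bigA /=.
by congr (_ + _); apply: eq_bigr => -[i j] _; rewrite phiZ.
Qed.

Lemma tensor_functional_scalar phi psi :
  scalar (tensor_functional phi psi : tensor_square R n -> C).
Proof.
move=> z S T; rewrite /tensor_functional mulr_sumr -big_split /=.
by apply: eq_bigr => bc _; rewrite !ffunE mulrDl; congr (_ + _); rewrite -mulrA.
Qed.

Lemma coproduct_linear : linear (@coproduct R n).
Proof.
move=> z x y; rewrite /coproduct scalerDr addrACA.
congr (_ + _); rewrite scaler_sumr -big_split /=; apply: eq_bigr => i _;
  rewrite scaler_sumr -big_split /=; apply: eq_bigr => j _.
  by rewrite !ffunE scalerDl scalerA.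
by rewrite !mxE scalerDl scalerA.
Qed.

Lemma convolution_scalar phi psi : scalar (convolution phi psi).
Proof.
by move=> z x y; rewrite /convolution coproduct_linear tensor_functional_scalar.
Qed.

Lemma convolutionE phi psi (x : A) : scalar phi -> scalar psi ->
  convolution phi psi x
  = \sum_(i : 'Z_n) \sum_(j : 'Z_n) x.1 (i, j)
      * (\sum_(s : 'Z_n) \sum_(t : 'Z_n)
           phi (e_ R s t) * psi (e_ R (i - s) (j - t))
         + n%:R^-1 * \sum_(k : 'Z_n) \sum_(r : 'Z_n) etaX R (i * (k - r))
           * (phi (E_ R k r) * psi (E_ R (k + j) (r + j))))
  + \sum_(i : 'Z_n) \sum_(j : 'Z_n) x.2 i j
      * (\sum_(s : 'Z_n) \sum_(t : 'Z_n) etaX R (s * (i - j))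
           * (phi (e_ R (- s) (- t)) * psi (E_ R (i - t) (j - t)))
         + \sum_(s : 'Z_n) \sum_(t : 'Z_n) etaX R (s * (j - i))
           * (phi (E_ R (i - t) (j - t)) * psi (e_ R s t))).
Proof.
move=> phi_lin psi_lin; rewrite /convolution /coproduct.
have [gD gZ gS] := scalar_morph (tensor_functional_scalar phi psi).
have gT x' y' := tensor_functional_tensor x' y' phi_lin psi_lin.
have gSS (G : 'Z_n -> 'Z_n -> tensor_square R n) :
    tensor_functional phi psi (\sum_i \sum_j G i j)
    = \sum_i \sum_j tensor_functional phi psi (G i j).
  by rewrite gS; apply: eq_bigr => i _; rewrite gS.
rewrite gD !gSS; congr (_ + _); apply: eq_bigr => i _; apply: eq_bigr => j _;
  rewrite gZ gD ?gZ !gSS; congr (_ * (_ + _ * _)) || congr (_ * (_ + _));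
  by apply: eq_bigr => s _; apply: eq_bigr => t _; rewrite ?gZ gT.
Qed.

Definition wchar u v : A := ([ffun p => etaX R (p.1 * u + p.2 * v)], 0).
Definition zchar u v : A :=
  (0, \matrix_(i, j) ((j == i + u)%:R * etaX R (i * v))).

Lemma sum_shift (u : 'Z_n) (F : 'Z_n -> 'Z_n -> C) :
  \sum_(i : 'Z_n) \sum_(j : 'Z_n) (j == i + u)%:R * F i j
  = \sum_(i : 'Z_n) F i (i + u).
Proof.
apply: eq_bigr => i _; rewrite (bigD1 (i + u)) //= eqxx mul1r big1 ?addr0 //.
by move=> j /negPf ->; rewrite mul0r.
Qed.

Lemma wcharE phi u v : scalar phi ->
  phi (wchar u v)
  = \sum_(i : 'Z_n) \sum_(j : 'Z_n) etaX R (i * u + j * v) * phi (e_ R i j).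
Proof.
move=> /scalar_coordE -> /=; rewrite [X in _ + X]big1 ?addr0.
  by apply: eq_bigr => i _; apply: eq_bigr => j _; rewrite ffunE.
by move=> i _; apply: big1 => j _; rewrite mxE mul0r.
Qed.

Lemma zcharE phi u v : scalar phi ->
  phi (zchar u v) = \sum_(i : 'Z_n) etaX R (i * v) * phi (E_ R i (i + u)).
Proof.
move=> /scalar_coordE -> /=; rewrite [X in X + _]big1 ?add0r; last first.
  by move=> i _; apply: big1 => j _; rewrite ffunE mul0r.
rewrite -(sum_shift u (fun i j => etaX R (i * v) * phi (E_ R i j))).
by apply: eq_bigr => i _; apply: eq_bigr => j _; rewrite mxE mulrA.
Qed.

(* The matrix [[wchar u (-v), zchar u v], [zchar u (-v), wchar u v]] is a
   corepresentation, for all u and v. *)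
Lemma convolution_wchar phi psi u v : scalar phi -> scalar psi ->
  convolution phi psi (wchar u v)
  = phi (wchar u v) * psi (wchar u v) + phi (zchar u (- v)) * psi (zchar u v).
Proof.
move=> phi_lin psi_lin; rewrite convolutionE //.
rewrite [X in _ + X]big1 ?addr0; last first.
  by move=> i _; apply: big1 => j _; rewrite mxE mul0r.
under eq_bigr do [under eq_bigr do rewrite ffunE mulrDr /=; rewrite big_split].
rewrite big_split /=; congr (_ + _).
- rewrite !wcharE // !pair_bigA /= big_distrlr /=.
  under eq_bigr => p _ do rewrite pair_bigA mulr_sumr /=.
  rewrite exchange_big /=; apply: eq_bigr => -[s t] _ /=.
  rewrite (reindex_inj (addrI (s, t))) /=; apply: eq_bigr => -[i j] _ /=.
  rewrite ![_ + _ - _]addrAC !subrr !add0r !mulrDl addrACA etaXD; ring.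
- rewrite !zcharE // big_distrlr /=.
  (* The sum over i is isolated: it is n if r = k + u and 0 otherwise, so it absorbs the factor 1/n
     and leaves a single value of r. *)
  transitivity (\sum_(k : 'Z_n) \sum_(r : 'Z_n) \sum_(j : 'Z_n)
    (\sum_(i : 'Z_n) etaX R (i * (u + k - r))) * (n%:R^-1 * (etaX R (j * v) *
       (phi (E_ R k r) * psi (E_ R (k + j) (r + j)))))).
    under eq_bigr => i _ do
      under eq_bigr => j _ do [rewrite pair_bigA !mulr_sumr /=].
    under eq_bigr => i _ do rewrite exchange_big /=.
    rewrite exchange_big [RHS]pair_bigA /=; apply: eq_bigr => -[k r] _ /=.
    rewrite exchange_big /=; apply: eq_bigr => j _; rewrite mulr_suml.
    apply: eq_bigr => i _.
    rewrite -[u + k - r]addrA [i * (u + _)]mulrDr !etaXD; ring.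
  apply: eq_bigr => k _.
  rewrite (bigD1 (k + u)) //= [X in _ + X]big1 ?addr0; last first.
    move=> r rk; apply: big1 => j _; rewrite sum_etaX subr_eq0 addrC eq_sym.
    by rewrite (negPf rk) mulr0 mul0r.
  (* Shifting j by k turns the second matrix unit into E_{j,j+u}; the phase left over is what makes
     the first factor [zchar u (- v)]. *)
  rewrite (reindex_inj (addIr (- k))) /=; apply: eq_bigr => j _.
  rewrite sum_etaX [u + k]addrC subrr eqxx mulr1 mulVKf ?pnatr_eq0 //.
  have -> : k + (j - k) = j by ring.
  have -> : k + u + (j - k) = j + u by ring.
  rewrite mulrBl etaXD mulrN; ring.
Qed.

Lemma convolution_zchar phi psi u v : scalar phi -> scalar psi ->
  convolution phi psi (zchar u v)
  = phi (wchar u (- v)) * psi (zchar u v) + phi (zchar u v) * psi (wchar u v).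
Proof.
move=> phi_lin psi_lin; rewrite convolutionE //.
rewrite [X in X + _]big1 ?add0r; last first.
  by move=> i _; apply: big1 => j _; rewrite ffunE mul0r.
under eq_bigr do under eq_bigr do rewrite mxE -mulrA.
rewrite sum_shift; under eq_bigr do rewrite mulrDr.
rewrite big_split /=; congr (_ + _).
- rewrite wcharE // zcharE // pair_bigA big_distrlr /=.
  under eq_bigr => i _ do rewrite pair_bigA mulr_sumr /=.
  (* The coproduct involves e_(-s,-t) here. Negating (s, t), then shifting i, leaves the exponent su
     - tv, whence [wchar u (- v)]. *)
  rewrite exchange_big (reindex_inj (@oppr_inj ('Z_n * 'Z_n)%type)) /=.
  apply: eq_bigr => -[s t] _ /=; rewrite (reindex_inj (addrI (- t))) /=.
  apply: eq_bigr => i _; rewrite !opprK.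
  have -> : - t + i + t = i by ring.
  have -> : - t + i + u + t = i + u by ring.
  have -> : - s * (- t + i - (- t + i + u)) = s * u by ring.
  rewrite mulrDl mulNr mulrN !etaXD; ring.
- rewrite wcharE // zcharE // pair_bigA big_distrlr /=.
  under eq_bigr => i _ do rewrite pair_bigA mulr_sumr /=.
  rewrite exchange_big [RHS]exchange_big /=.
  apply: eq_bigr => -[s t] _ /=; rewrite (reindex_inj (addIr t)) /=.
  apply: eq_bigr => i _.
  have -> : i + t - t = i by ring.
  have -> : i + t + u - t = i + u by ring.
  have -> : s * (i + t + u - (i + t)) = s * u by ring.
  rewrite mulrDl !etaXD; ring.
Qed.

End Convolution.

Lemma half_sum_diff (F : numFieldType) (x y x' y' : F) :
  x + y = x' + y' -> x - y = x' - y' -> x = x' /\ y = y'.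
Proof.
have idl a b : a = ((a + b) + (a - b)) / 2 :> F by field.
have idr a b : b = ((a + b) - (a - b)) / 2 :> F by field.
move=> eqD eqB; split; first by rewrite (idl x y) eqD eqB -idl.
by rewrite (idr x y) eqD eqB -idr.
Qed.

(** * Convolution powers of functionals invariant under v |-> -v *)

Section Powers.
Variables (R : realType) (m : nat).
Local Notation n := m.+2.
Local Notation C := R[i].
Local Notation A := (sekine R n).
Implicit Types (phi psi : A -> C) (u v : 'Z_n).

Lemma counit_scalar : scalar (@counit R n).
Proof. by move=> a x y; rewrite /counit !ffunE. Qed.

Lemma conv_pow_scalar phi k : scalar (conv_pow phi k).
Proof.
by case: k => [|k]; [exact: counit_scalar | exact: convolution_scalar].
Qed.

Definition dual (x : 'Z_n * 'Z_n * bool) : A :=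
  wchar R x.1.1 x.1.2
  + ((if x.2 then 1 else -1) : C) *: zchar R x.1.1 x.1.2.

Definition vflip (x : 'Z_n * 'Z_n * bool) := (x.1.1, - x.1.2, x.2).

Lemma scalar_dual phi (phi_lin : scalar phi) x :
  phi (dual x) = phi (wchar R x.1.1 x.1.2)
    + (if x.2 then 1 else -1) * phi (zchar R x.1.1 x.1.2).
Proof. by have [D Z _] := scalar_morph phi_lin; rewrite D Z. Qed.

Lemma counit_wchar u v : counit (wchar R u v) = 1.
Proof. by rewrite /counit ffunE !mul0r addr0. Qed.

Lemma counit_zchar u v : counit (zchar R u v) = 0.
Proof. by rewrite /counit ffunE. Qed.

Section Even.
Variable phi : A -> C.
Hypotheses (phi_lin : scalar phi)
           (phi_even : forall x, phi (dual (vflip x)) = phi (dual x)).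

Lemma even_chars u v : phi (wchar R u (- v)) = phi (wchar R u v)
  /\ phi (zchar R u (- v)) = phi (zchar R u v).
Proof.
have eq b :
    phi (wchar R u (- v)) + (if b then 1 else -1) * phi (zchar R u (- v))
    = phi (wchar R u v) + (if b then 1 else -1) * phi (zchar R u v).
  by have := phi_even (u, v, b); rewrite !(scalar_dual phi_lin).
have := eq false; have := eq true; rewrite !mul1r !mulN1r.
exact: half_sum_diff.
Qed.

(** Negating v in either convolution formula only negates v in each factor, so invariance passes to
    convolution powers. *)
Lemma conv_pow_even_chars k u v :
  conv_pow phi k (wchar R u (- v)) = conv_pow phi k (wchar R u v)
  /\ conv_pow phi k (zchar R u (- v)) = conv_pow phi k (zchar R u v).
Proof.
elim: k => [|k IHk] in v *.
  by rewrite /= !counit_wchar !counit_zchar.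
have lin_k := conv_pow_scalar phi k.
have [w1 z1] := even_chars u v; have [w2 z2] := IHk v.
rewrite [conv_pow phi k.+1]/=.
rewrite !(convolution_wchar _ _ lin_k phi_lin).
by rewrite !(convolution_zchar _ _ lin_k phi_lin) opprK w1 z1 w2 z2.
Qed.

(** By invariance, phi takes on the corepresentation the values [[w, z], [z, w]]. Such matrices are
    diagonalised simultaneously, with eigenvalues w + z and w - z, which therefore multiply under
    convolution. *)
Lemma conv_pow_dual k x : conv_pow phi k (dual x) = phi (dual x) ^+ k.
Proof.
elim: k => [|k IHk] in x *.
  apply: etrans (scalar_dual counit_scalar x) _.
  by rewrite counit_wchar counit_zchar mulr0 addr0 expr0.
have lin_k := conv_pow_scalar phi k.
rewrite exprSr -IHk [conv_pow phi k.+1]/=.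
rewrite (scalar_dual lin_k) (scalar_dual phi_lin).
rewrite (scalar_dual (convolution_scalar _ _)).
rewrite (convolution_wchar _ _ lin_k phi_lin).
rewrite (convolution_zchar _ _ lin_k phi_lin).
have [-> ->] := conv_pow_even_chars k x.1.1 x.1.2.
by case: x.2; ring.
Qed.

End Even.

End Powers.

(** * Plancherel formula and the bound on projections *)

Section Plancherel.
Variables (R : realType) (m : nat).
Local Notation n := m.+2.
Local Notation C := R[i].
Local Notation A := (sekine R n).
Implicit Types (g : A -> C) (u v : 'Z_n).

Lemma parseval (f : 'Z_n -> C) :
  \sum_(u : 'Z_n) `|\sum_(s : 'Z_n) etaX R (s * u) * f s| ^+ 2
  = n%:R * \sum_(s : 'Z_n) `|f s| ^+ 2.
Proof.
transitivity (\sum_(s : 'Z_n) \sum_(t : 'Z_n)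
    f s * Num.conj (f t) * \sum_(u : 'Z_n) etaX R (u * (s - t))).
  under eq_bigr => u _ do rewrite normCK rmorph_sum big_distrlr /=.
  rewrite exchange_big; apply: eq_bigr => s _.
  rewrite exchange_big; apply: eq_bigr => t _.
  rewrite mulr_sumr; apply: eq_bigr => u _.
  rewrite rmorphM /= conj_etaX mulrBr etaXD ![u * _]mulrC; ring.
rewrite mulr_sumr; apply: eq_bigr => s _.
rewrite (bigD1 s) //= subrr sum_etaX eqxx mulr1 big1 ?addr0.
  by rewrite normCK mulrC.
move=> t ts; rewrite sum_etaX subr_eq0 eq_sym.
by move/negPf: ts => ->; rewrite !mulr0.
Qed.

Lemma parallelogram (K : numClosedFieldType) (x y : K) :
  `|x + y| ^+ 2 + `|x - y| ^+ 2 = 2 * (`|x| ^+ 2 + `|y| ^+ 2).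
Proof. by rewrite !normCK !rmorphD !rmorphN; ring. Qed.

(** The parallelogram law separates w from z. The w part is a Fourier transform in both indices,
    giving n^2; in the z part u only labels a diagonal, so [parseval] applies once and gives n. *)
Lemma plancherel g : scalar g ->
  \sum_x `|g (dual R x)| ^+ 2
  = 2 * n%:R * (n%:R * (\sum_(i : 'Z_n) \sum_(j : 'Z_n) `|g (e_ R i j)| ^+ 2)
                + \sum_(i : 'Z_n) \sum_(j : 'Z_n) `|g (E_ R i j)| ^+ 2).
Proof.
move=> g_lin.
transitivity (\sum_(u : 'Z_n) \sum_(v : 'Z_n)
    2 * (`|g (wchar R u v)| ^+ 2 + `|g (zchar R u v)| ^+ 2)).
  rewrite pair_bigA -(pair_bigA_idem (addr0 0)
    (fun p b => `|g (dual R (p, b))| ^+ 2)) /=.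
  apply: eq_bigr => -[u v] _; rewrite big_bool !(scalar_dual g_lin) /=.
  by rewrite mul1r mulN1r parallelogram.
under eq_bigr do rewrite -mulr_sumr big_split.
rewrite -mulr_sumr big_split -mulrA; congr (_ * _); rewrite mulrDr.
congr (_ + _) => /=.
- under eq_bigr => u _ do [under eq_bigr => v _ do
    [rewrite (wcharE _ _ g_lin) exchange_big /=;
     under eq_bigr => j _ do
       [under eq_bigr => i _ do rewrite addrC etaXD -mulrA; rewrite -mulr_sumr];
     over]; rewrite parseval; over].
  rewrite -mulr_sumr; congr (_ * _).
  rewrite exchange_big [in RHS]exchange_big /=.
  by rewrite mulr_sumr; apply: eq_bigr => j _; rewrite parseval.
- under eq_bigr => u _ do [under eq_bigr => v _ do rewrite (zcharE _ _ g_lin);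
    rewrite parseval; over].
  rewrite -mulr_sumr; congr (_ * _); rewrite exchange_big.
  by apply: eq_bigr => i _; rewrite [RHS](reindex_inj (addrI i)).
Qed.

(** Lagrange's identity: twice the difference of the two sides, symmetrised in i and j, is a sum of
    squares divided by w_i w_j. *)
Lemma weighted_CauchySchwarz (K : numFieldType) (I : finType) (w a b : I -> K) :
  (forall i, 0 < w i) -> (forall i, a i \is Num.real) ->
  (forall i, b i \is Num.real) ->
  (\sum_i a i * b i) ^+ 2
  <= (\sum_i w i * a i ^+ 2) * (\sum_i (w i)^-1 * b i ^+ 2).
Proof.
move=> w_gt0 a_real b_real.
rewrite -(ler_pM2l (ltr0Sn K 1)) expr2 !big_distrlr /=.
rewrite [X in _ <= X]mulr_natl mulr2n [X in _ <= _ + X]exchange_big.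
rewrite -!big_split /= mulr_sumr; apply: ler_sum => i _.
rewrite -big_split mulr_sumr; apply: ler_sum => j _.
have wi := w_gt0 i; have wj := w_gt0 j.
rewrite -subr_ge0 (_ : _ - _
  = (w i * a i * b j - w j * a j * b i) ^+ 2 / (w i * w j)).
  apply: divr_ge0; last by rewrite mulr_ge0 ?ltW.
  rewrite real_exprn_even_ge0 //.
  by rewrite rpredB ?rpredM // gtr0_real.
by rewrite /=; field; rewrite !gt_eqF.
Qed.

(** Cauchy-Schwarz for the Haar inner product: the first factor divided by 2n^2 is
    [haar (star x * x)], and [plancherel] identifies the dual norm of g. *)
Lemma ler_norm_scalar g (x : A) : scalar g ->
  `|g x| ^+ 2
  <= (\sum_(i : 'Z_n) \sum_(j : 'Z_n) `|x.1 (i, j)| ^+ 2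
      + n%:R * \sum_(i : 'Z_n) \sum_(j : 'Z_n) `|x.2 i j| ^+ 2)
     * (\sum_(y : 'Z_n * 'Z_n * bool) `|g (dual R y)| ^+ 2)
     / (2 * n%:R ^+ 2).
Proof.
move=> g_lin; rewrite plancherel //.
(* These are the relative weights of e_(i,j) and E_{i,j} in the squared Haar norm. *)
pose w (b : basis_index n) : C := if b is inl _ then 1 else n%:R.
have w_gt0 b : 0 < w b by case: b => ? /=; rewrite ?ltr01 ?ltr0Sn.
have [_ gZ gS] := scalar_morph g_lin.
have CS := weighted_CauchySchwarz w_gt0 (fun b => normr_real (Defs.coord x b))
  (fun b => normr_real (g (Defs.basis R b))).
have le_CS :
    `|g x| ^+ 2 <= (\sum_b `|Defs.coord x b| * `|g (Defs.basis R b)|) ^+ 2.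
  apply: lerXn2r; rewrite ?nnegrE ?sumr_ge0 //.
  rewrite [in X in X <= _](basis_coord x) gS (le_trans (ler_norm_sum _ _ _)) //.
  by apply: ler_sum => b _; rewrite gZ normrM.
apply: le_trans (le_trans le_CS CS) _; rewrite le_eqVlt; apply/orP; left.
apply/eqP; rewrite !big_sumType /= !pair_bigA -!mulr_sumr /= invr1 !mul1r.
have n_neq0 : n%:R != 0 :> C by rewrite pnatr_eq0.
rewrite -mulrA; congr (_ * _).
  by congr (_ + _ * _); apply: eq_bigr => -[].
by field.
Qed.

Lemma projection_bound g (p : A) : scalar g -> g 1 = 0 -> projection p ->
  `|g p| ^+ 2 <= 4^-1 * \sum_(y : 'Z_n * 'Z_n * bool) `|g (dual R y)| ^+ 2.
Proof.
move=> g_lin g1 [p_idem p_star].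
have [gD gZ _] := scalar_morph g_lin.
(* x = p - 1/2 is self-adjoint with square 1/4. *)
pose x : A := ([ffun q => p.1 q - 2^-1], p.2 - (2^-1)%:M).
have pE : p = x + (2^-1 : C) *: (1 : A).
  rewrite [LHS]surjective_pairing; congr pair => /=.
    by apply/ffunP => q; rewrite !ffunE [_ *: _]mulr1 subrK.
  by rewrite scalemx1 subrK.
have -> : g p = g x by rewrite {1}pE gD gZ g1 mulr0 addr0.
have n_neq0 : n%:R != 0 :> C by rewrite pnatr_eq0.
have p1_idem q : p.1 q * p.1 q = p.1 q.
  by rewrite -[in RHS]p_idem ffunE.
have p1_conj q : Num.conj (p.1 q) = p.1 q.
  by rewrite -[in RHS]p_star ffunE.
have p2_idem : p.2 *m p.2 = p.2 by rewrite -[in RHS]p_idem.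
have p2_conj i j : Num.conj (p.2 j i) = p.2 i j.
  by rewrite -[in RHS]p_star mxE.
have conj_half : Num.conj (2^-1 : C) = 2^-1 by rewrite fmorphV rmorph_nat.
apply: le_trans (ler_norm_scalar x g_lin) _.
rewrite le_eqVlt; apply/orP; left; apply/eqP; rewrite mulrAC; congr (_ * _).
rewrite (eq_bigr (fun=> n%:R * 4^-1)); last first.
  move=> i _; rewrite -[n in n%:R]card_ord mulr_natl -sumr_const.
  apply: eq_bigr => j _; rewrite ffunE normCK rmorphB /= conj_half p1_conj.
  by rewrite mulrBl mulrBr p1_idem; field.
(* Since x is self-adjoint, the squared norm of row i is the i-th diagonal entry of x^2 = 1/4. *)
rewrite [X in _ + _ * X](eq_bigr (fun=> 4^-1)); last first.
  move=> i _; transitivity ((x.2 *m x.2) i i).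
    rewrite mxE; apply: eq_bigr => j _; rewrite normCK !mxE rmorphB /= p2_conj.
    by rewrite eq_sym rmorphMn /= conj_half.
  rewrite mulmxBl !mulmxBr p2_idem mul_mx_scalar mul_scalar_mx -scalar_mxM.
  by rewrite !mxE eqxx !mulr1n; field.
(* Both summands contribute n^2/4, and (n^2/4 + n^2/4) / (2n^2) = 1/4. *)
rewrite !sumr_const !card_ord -[_ * _ *+ _]mulr_natl -[4^-1 *+ _]mulr_natl.
by field.
Qed.

End Plancherel.

(** * Orthogonality, characters, and the irreducible representation attached to each triple *)

Section Coefficients.
Variables (R : realType) (m : nat).
Local Notation n := m.+2.
Local Notation C := R[i].
Local Notation A := (sekine R n).
Implicit Types (x y : A) (u v : 'Z_n).

Lemma fourierE x y :
  fourier x y = (2 * n%:R ^+ 2)^-1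
    * (\sum_(i : 'Z_n) \sum_(j : 'Z_n) x.1 (i, j) * y.1 (i, j)
       + n%:R * \sum_(i : 'Z_n) \sum_(j : 'Z_n) x.2 i j * y.2 j i).
Proof.
rewrite /fourier /haar /=; congr (_ * (_ + _ * _)).
  by apply: eq_bigr => i _; apply: eq_bigr => j _; rewrite ffunE mulrC.
rewrite exchange_big; apply: eq_bigr => i _; rewrite mxE.
by apply: eq_bigr => j _; rewrite mulrC.
Qed.

(** The Haar state is a trace, so [fourier] is a symmetric bilinear form and [fourier_scalar] serves
    for both arguments. *)
Lemma fourierC x y : fourier x y = fourier y x.
Proof.
rewrite !fourierE; congr (_ * (_ + _ * _)).
  by apply: eq_bigr => i _; apply: eq_bigr => j _; rewrite mulrC.
rewrite exchange_big; apply: eq_bigr => i _.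
by apply: eq_bigr => j _; rewrite mulrC.
Qed.

Lemma fourier_scalar x : scalar (fourier x).
Proof.
move=> a y z; rewrite !fourierE [a * (_ * _)]mulrCA -[RHS]mulrDr; congr (_ * _).
rewrite mulrDr addrACA [a * (n%:R * _)]mulrCA -mulrDr.
congr (_ + _ * _); rewrite mulr_sumr -big_split; apply: eq_bigr => i _;
  rewrite mulr_sumr -big_split; apply: eq_bigr => j _ /=.
  by rewrite !ffunE mulrDr; congr (_ + _); exact: mulrCA.
by rewrite !mxE mulrDr mulrCA.
Qed.

Lemma sum_e_ (f : 'Z_n -> 'Z_n -> C) :
  \sum_(i : 'Z_n) \sum_(j : 'Z_n) f i j *: e_ R i j
  = ([ffun p => f p.1 p.2], 0).
Proof.
rewrite [RHS]basis_coord big_sumType /= [X in _ = _ + X]big1 ?addr0.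
  by rewrite pair_bigA; apply: eq_bigr => -[i j] _; rewrite ffunE.
by move=> p _; rewrite mxE scale0r.
Qed.

Lemma sum_E_ l (f : 'Z_n -> C) :
  \sum_(k : 'Z_n) f k *: E_ R k (k + l)
  = (0, \matrix_(i, j) ((j == i + l)%:R * f i)).
Proof.
rewrite [RHS]basis_coord big_sumType /= [X in _ = X + _]big1 ?add0r; last first.
  by move=> p _; rewrite ffunE scale0r.
rewrite -(pair_bigA _ (fun i j => (\matrix_(i, j) ((j == i + l)%:R * f i)) i j
  *: E_ R i j)) /=.
apply: eq_bigr => i _.
rewrite (bigD1 (i + l)) //= mxE eqxx mul1r big1 ?addr0 //.
by move=> j /negPf jl; rewrite mxE jl mul0r scale0r.
Qed.

Lemma fourier_wchar u v u' v' :
  fourier (wchar R u v) (wchar R u' v')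
  = 2^-1 * ((u' == - u) && (v' == - v))%:R.
Proof.
have n_neq0 : n%:R != 0 :> C by rewrite pnatr_eq0.
rewrite fourierE [X in _ + _ * X]big1 ?mulr0 ?addr0; last first.
  by move=> i _; apply: big1 => j _; rewrite !mxE mul0r.
under eq_bigr => i _ do [under eq_bigr => j _ do
  [rewrite !ffunE /= -etaXD addrACA -!mulrDr etaXD; over];
  rewrite -mulr_sumr sum_etaX; over].
rewrite -mulr_suml sum_etaX !addr_eq0 -!(eqr_oppLR u) -!(eqr_oppLR v).
by rewrite ![- _ == _]eq_sym; do 2!case: eqP => _ /=; field.
Qed.

Lemma fourier_wzchar u v u' v' : fourier (wchar R u v) (zchar R u' v') = 0.
Proof.
rewrite fourierE [X in _ * (X + _)]big1 => [|i _]; last first.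
  by apply: big1 => j _; rewrite !ffunE mulr0.
rewrite [X in _ * (_ + _ * X)]big1 => [|i _]; last first.
  by apply: big1 => j _; rewrite !mxE mul0r.
by rewrite mulr0 addr0 mulr0.
Qed.

(** In the trace, row i of the first matrix meets row i + u of the second; this shift produces the
    phase eta^(uv'). *)
Lemma fourier_zchar u v u' v' :
  fourier (zchar R u v) (zchar R u' v')
  = 2^-1 * ((u' == - u) && (v' == - v))%:R * etaX R (u * v').
Proof.
have n_neq0 : n%:R != 0 :> C by rewrite pnatr_eq0.
rewrite fourierE [X in _ * (X + _)]big1 ?add0r; last first.
  by move=> i _; apply: big1 => j _; rewrite !ffunE mul0r.
under eq_bigr => i _ do under eq_bigr => j _ do rewrite !mxE -mulrA.
rewrite sum_shift.
under eq_bigr => i _.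
  rewrite -addrA -[X in X == _]addr0 (inj_eq (addrI i)) mulrCA -etaXD mulrDl.
  rewrite addrA -mulrDr etaXD.
  over.
rewrite -mulr_sumr -mulr_suml sum_etaX.
rewrite ![0 == _]eq_sym ![u + _]addrC ![v + _]addrC !addr_eq0.
by do 2!case: eqP => _ /=; field.
Qed.

Definition sign (b : bool) : C := if b then 1 else -1.

Lemma fourier_dual u v b u' v' b' :
  fourier (dual R (u, v, b)) (dual R (u', v', b'))
  = 2^-1 * ((u' == - u) && (v' == - v))%:R
    * (1 + sign b * sign b' * etaX R (u * v')).
Proof.
rewrite (scalar_dual (fourier_scalar _)) ![fourier (dual _ _) _]fourierC.
rewrite !(scalar_dual (fourier_scalar _)) /= fourier_wchar fourier_wzchar.
rewrite [fourier (zchar _ _ _) (wchar _ _ _)]fourierC fourier_wzchar.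
rewrite [fourier (zchar _ _ _) _]fourierC fourier_zchar /sign.
have opp_sym (x y : 'Z_n) : (x == - y) = (y == - x).
  by rewrite -eqr_oppLR eq_sym.
rewrite (opp_sym u) (opp_sym v) mulr0 addr0 add0r.
by case: b; case: b'; ring.
Qed.

(** For even n, the only element of order 2 in Z/nZ; it is the index v of the [Sigma] characters. *)
Definition midpoint : 'Z_n := inZp n./2.

Lemma val_midpoint : val midpoint = n./2.
Proof.
have half_lt : (n./2 < n)%N by lia.
exact: modn_small half_lt.
Qed.

Lemma midpoint_neq0 : midpoint != 0.
Proof. by rewrite -val_eqE val_midpoint. Qed.

Lemma double_midpoint : ~~ odd n -> midpoint + midpoint = 0.
Proof.
move=> n_even; apply: val_inj.
transitivity ((val midpoint + val midpoint) %% n)%N => //.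
by rewrite val_midpoint addnn even_halfK // modnn.
Qed.

Lemma eq_midpoint v : (v == midpoint) && ~~ odd n = (v != 0) && (v + v == 0).
Proof.
have vn : (val v < n)%N := ltn_ord v.
have -> : (v == midpoint) = (val v == n./2) by rewrite -val_midpoint.
have -> : (v != 0) = (val v != 0%N) by [].
have -> : (v + v == 0) = ((val v + val v) %% n == 0)%N by [].
move: (val v) vn => x xn.
(* As x + x < 2n, at most one subtraction of n computes the residue. *)
have [lt_n|le_n] := ltnP (x + x) n; first by rewrite modn_small //; lia.
by rewrite -(subnK le_n) modnDr modn_small; lia.
Qed.

Lemma character_Rho l b : character R (Rho l b) = @dual R m (l, 0, b).
Proof.
rewrite /= /dual /= /wchar /zchar; congr (_ + _ *: _).
  rewrite (sum_e_ (fun i j => etaX R (i * l))); congr (_, _).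
  by apply/ffunP => p; rewrite !ffunE mulr0 addr0.
transitivity (\sum_(k : 'Z_n) (1 : C) *: E_ R k (k + l)).
  by apply: eq_bigr => k _; rewrite scale1r.
rewrite sum_E_; congr (_, _).
by apply/matrixP => i j; rewrite !mxE mulr0 etaX0.
Qed.

Lemma character_Sigma (n_even : ~~ odd n) l b :
  character R (Sigma n_even l b) = @dual R m (l, midpoint, b).
Proof.
have signE (i : 'Z_n) : (-1) ^+ i = etaX R (i * midpoint).
  by apply: sign_etaX; rewrite ?midpoint_neq0 ?double_midpoint.
rewrite /= /dual /= /wchar /zchar; congr (_ + _ *: _).
  rewrite (sum_e_ (fun i j => (-1) ^+ j * etaX R (i * l))); congr (_, _).
  by apply/ffunP => p; rewrite !ffunE signE etaXD mulrC.
rewrite (sum_E_ _ (fun k => (-1) ^+ k)); congr (_, _).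
by apply/matrixP => i j; rewrite !mxE signE.
Qed.

(** Twice the cosine is eta^(tv) plus its conjugate eta^(-tv). *)
Lemma character_Xrep u (v : {v : 'I_n | (1 <= v <= (n - 1)./2)%N}) :
  character R (Xrep u v)
  = @wchar R m u (inZp (val v)) + @wchar R m u (- inZp (val v)).
Proof.
rewrite /= (sum_e_ (fun s t => etaX R (s * u)
  * (cos (2 * (t : nat)%:R * (val v : nat)%:R * pi / n%:R))%:C%C)).
rewrite /wchar; congr (_, _); last by rewrite scaler0 addr0.
apply/ffunP => -[s t]; rewrite !ffunE /= !etaXD mulrN -conj_etaX -mulrDr.
rewrite [LHS]mulrCA; congr (_ * _).
rewrite (@etaX_mod R m (t * val v)); last first.
  by rewrite /= [in RHS]modn_mod modnMmr.
rewrite de_moivre [RHS]addcJ /=; congr (_ * (cos _)%:C%C).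
by rewrite natrM; ring.
Qed.

(* [dual_of alpha x] holds when [dual R x] belongs to the span of the matrix
   coefficients of the conjugate representation of [alpha]. *)
Definition dual_of (alpha : irrep n) (x : 'Z_n * 'Z_n * bool) : bool :=
  let: (u, v, b) := x in
  match alpha with
  | Rho l b' => [&& u == - l, v == 0 & b == b']
  | Xrep l v' =>
      (u == - l) && ((v == inZp (val v')) || (v == - inZp (val v')))
  | Sigma _ l b' => [&& u == - l, v == midpoint & b == b' (+) odd u]
  end.

Lemma val_inZp_Xrep (v : {v : 'I_n | (1 <= v <= (n - 1)./2)%N}) :
  val (inZp (val v) : 'Z_n) = val (val v).
Proof. exact: modn_small (ltn_ord (val v)). Qed.

(** Passing to representatives makes the case analyses on v linear arithmetic; v' >= 1 keeps n - v'
    below n. *)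
Lemma eq_Xrep (v' : {v : 'I_n | (1 <= v <= (n - 1)./2)%N}) v :
  (v == inZp (val v')) || (v == - inZp (val v'))
  = (v == val v' :> nat) || (v == n - val v' :> nat)%N.
Proof.
have /andP[v'_gt0 _] := valP v'; have v'_lt := ltn_ord (val v').
rewrite -!val_eqE val_inZp_Xrep; congr (_ || (_ == _)).
transitivity ((n - val (inZp (val v') : 'Z_n)) %% n)%N => //.
rewrite val_inZp_Xrep modn_small //; move: v'_gt0 v'_lt => /=.
by move: (nat_of_ord (val v')) => w; lia.
Qed.

(** Otherwise v' would have order 2, hence be n/2 with n even, above the upper limit (n - 1)/2. *)
Lemma Xrep_neq_opp (v' : {v : 'I_n | (1 <= v <= (n - 1)./2)%N}) :
  (inZp (val v') : 'Z_n) != - inZp (val v').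
Proof.
rewrite -addr_eq0; apply/negP => ww; have w_val := val_inZp_Xrep v'.
have w_bd := valP v'; have := eq_midpoint (inZp (val v')); rewrite ww andbT.
have -> : inZp (val v') != 0 :> 'Z_n.
  by rewrite -val_eqE w_val -lt0n; case/andP: w_bd.
move=> /andP[/eqP w_mid n_even]; move: w_val w_bd; rewrite w_mid val_midpoint.
rewrite -[val (val v')]/(nat_of_ord (val v')).
by move: (nat_of_ord (val v')) => w /=; move: n_even => /=; lia.
Qed.

(** Negation fixes 0 and, for even n, [midpoint], and it swaps the two values of v allowed for an
    [Xrep]. *)
Lemma dual_of_flip alpha q : dual_of alpha (vflip q) = dual_of alpha q.
Proof.
case: q => -[u v] b; case: alpha => [l b'|l v'|n_even l b'] /=.
- by rewrite oppr_eq0.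
- by rewrite eqr_opp eqr_oppLR orbC.
- rewrite eqr_oppLR; have /eqP := double_midpoint n_even.
  by rewrite addr_eq0 => /eqP <-.
Qed.

(** With [dual_of_exists], this partitions the triples: v = 0 belongs to [Rho], v of order 2 to
    [Sigma], and the remaining pairs {v, -v} to [Xrep]. *)
Lemma dual_of_inj alpha beta q :
  dual_of alpha q -> dual_of beta q -> alpha = beta.
Proof.
(* The indices of [Xrep] avoid both fixed points of negation, which separates the three families. *)
have X0 (v' : {v : 'I_n | (1 <= v <= (n - 1)./2)%N}) v :
    (v == inZp (val v')) || (v == - inZp (val v'))
    -> (v != 0) && (~~ odd n ==> (v != midpoint)).
  rewrite eq_Xrep.
  have -> : (v == midpoint) = (v == n./2 :> nat) by rewrite -val_midpoint.
  have -> : (v != 0) = (v != 0%N :> nat) by [].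
  have := valP v'; move: (nat_of_ord v) (nat_of_ord (val v')) => x w; lia.
case: q => -[u v] b.
case: alpha => [l1 b1|l1 v1|n_even1 l1 b1];
  case: beta => [l2 b2|l2 v2|n_even2 l2 b2] /=.
- by move=> /and3P[/eqP-> _ /eqP->] /and3P[/eqP/oppr_inj-> _ /eqP->].
- by move=> /and3P[_ v0 _] /andP[_ /X0]; rewrite v0.
- move=> /and3P[_ /eqP v0 _] /and3P[_ /eqP vh _].
  by have := midpoint_neq0; rewrite -vh v0 eqxx.
- by move=> /andP[_ /X0/andP[/negP v0 _]] /and3P[_ /v0 []].
- move=> /andP[/eqP-> V1] /andP[/eqP/oppr_inj-> V2]; congr Xrep.
  apply: val_inj; apply: ord_inj.
  move: V1 V2; rewrite !eq_Xrep; have := valP v1; have := valP v2.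
  move: (nat_of_ord v) (nat_of_ord (val v1)) (nat_of_ord (val v2)).
  by move=> x w1 w2; lia.
- by move=> /andP[_ /X0]; rewrite n_even2 => /andP[_ /negP vh] /and3P[_ /vh []].
- move=> /and3P[_ /eqP vh _] /and3P[_ /eqP v0 _].
  by have := midpoint_neq0; rewrite -vh v0 eqxx.
- by move=> /and3P[_ vh _] /andP[_ /X0]; rewrite n_even1 vh andbF.
- move=> /and3P[/eqP-> _ /eqP->] /and3P[/eqP/oppr_inj-> _ /eqP/addIb->].
  by congr Sigma; exact: bool_irrelevance.
Qed.

Lemma dual_of_exists q : exists alpha, dual_of alpha q.
Proof.
case: q => -[u v] b; have [->|v_neq0] := eqVneq v 0.
  by exists (Rho (- u) b); rewrite /= opprK !eqxx.
have [vv|vv] := eqVneq (v + v) 0.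
  have := eq_midpoint v; rewrite v_neq0 vv eqxx => /andP[/eqP-> n_even].
  exists (Sigma n_even (- u) (b (+) odd u)).
  by rewrite /= opprK !eqxx -addbA addbb addbF eqxx.
have exX (w : 'Z_n) : (1 <= w <= (n - 1)./2)%N ->
    (v == w) || (v == - w) -> exists alpha, dual_of alpha (u, v, b).
  move=> w_bd vw; pose v' : {v : 'I_n | (1 <= v <= (n - 1)./2)%N} := Sub w w_bd.
  exists (Xrep (- u) v'); rewrite /= opprK eqxx /=.
  suff -> : inZp (val v') = w by [].
  by apply: val_inj; exact: val_inZp_Xrep v'.
(* Here v is neither 0 nor of order 2, so v or -v has its representative in the range of [Xrep]. *)
have [le_v|gt_v] := leqP (nat_of_ord v) (n - 1)./2.
  by refine (exX v _ _); rewrite ?eqxx // lt0n v_neq0.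
refine (exX (- v) _ _); last by rewrite opprK eqxx orbT.
have v_half : ~~ ((v == n./2 :> nat) && ~~ odd n).
  have -> : (v == n./2 :> nat) = (v == midpoint) by rewrite -val_midpoint.
  by rewrite eq_midpoint (negPf vv) andbF.
have vn : (v < n)%N := ltn_ord v.
have -> : nat_of_ord (- v) = (n - v)%N.
  transitivity ((n - v) %% n)%N => //.
  have : (0 < v)%N by rewrite lt0n v_neq0.
  by move=> v_gt0; rewrite modn_small //; lia.
move: (nat_of_ord v) vn v_half gt_v => x xn; lia.
Qed.

End Coefficients.

(** * Values of the functional on the dual basis, and the final estimate *)

Section Bound.
Variables (R : realType) (m : nat).
Local Notation n := m.+2.
Local Notation C := R[i].
Local Notation A := (sekine R n).
Implicit Types (alpha : irrep n) (q : 'Z_n * 'Z_n * bool).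

(** In dimension 1 the w and z parts contribute 1/2 each, adding up or cancelling according to the
    signs. For [Xrep] only one of the two w terms pairs with q, which leaves 1/2. *)
Lemma fourier_character alpha q :
  fourier (character R alpha) (dual R q)
  = (dual_of alpha q)%:R / (irrep_dim alpha)%:R.
Proof.
have oppCr (x y : 'Z_n) : (x == - y) = (y == - x).
  by rewrite -eqr_oppLR eq_sym.
case: q => -[u v] b; rewrite fourierC.
case: alpha => [l b'|l v'|n_even l b'].
- rewrite character_Rho fourier_dual mulr0 etaX0 [l == _]oppCr.
  rewrite [0 == _]eq_sym oppr_eq0 /sign /=.
  by case: b; case: b'; case: (u == - l); case: (v == 0) => /=; field.
- rewrite character_Xrep.
  have [D _ _] := scalar_morph (fourier_scalar (dual R (u, v, b))).
  rewrite D ![fourier (dual _ _) _]fourierC !(scalar_dual (fourier_scalar _)).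
  rewrite !fourier_wzchar !mulr0 !addr0 !fourier_wchar /=.
  rewrite opprK; case: (u == - l); last by rewrite /= !mulr0 addr0 mul0r.
  have := Xrep_neq_opp v'.
  have [->|_] := eqVneq v (inZp (val v')); last by rewrite /= mulr0 addr0 mulrC.
  by move=> /negPf ->; rewrite /= mulr0 add0r mulrC.
- rewrite character_Sigma fourier_dual /= [l == _]oppCr [midpoint _ == _]oppCr.
  have /eqP := double_midpoint n_even; rewrite addr_eq0 => /eqP <-.
  (* The phase of [fourier_zchar] is (-1)^u here; it explains the twist by [odd u] in [dual_of]. *)
  have <- : (-1) ^+ odd u = etaX R (u * midpoint m).
    rewrite signr_odd; apply: sign_etaX => //; first exact: midpoint_neq0.
    exact: double_midpoint.
  rewrite /sign; case: (u == - l); case: (v == _) => /=;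
    rewrite ?mulr0 ?mul0r //.
  by case: b; case: b'; case: (odd u) => /=; field.
Qed.

(** In dimension 1 the triple is determined; for [Xrep] there are two values of v and two signs. *)
Lemma leq_card_dual_of alpha : (#|dual_of alpha| <= irrep_dim alpha ^ 2)%N.
Proof.
case: alpha => [l b'|l v'|n_even l b'] /=.
- apply: (@leq_trans #|[set (- l, 0 : 'Z_n, b')]|); last by rewrite cards1.
  apply: subset_leq_card.
  by apply/fintype.subsetP => -[[u v] b] /and3P[/eqP-> /eqP-> /eqP->];
    rewrite inE.
- pose w : 'Z_n := inZp (val v').
  apply: leq_trans (card_size [:: (- l, w, true); (- l, w, false);
                                  (- l, - w, true); (- l, - w, false)]).
  apply/subset_leq_card/fintype.subsetP => -[[u v] b] /andP[/eqP->].
  by move=> /orP[]/eqP->; case: b; rewrite !inE eqxx ?orbT.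
- apply: (@leq_trans #|[set (- l, midpoint m, b' (+) odd (- l)%R)]|).
    apply: subset_leq_card.
    by apply/fintype.subsetP => -[[u v] b] /and3P[/eqP-> /eqP-> /eqP->];
    rewrite inE.
  by rewrite cards1.
Qed.

Section Main.
Variables (c : irrep n -> C) (a : A).
Hypothesis aE : a = \sum_alpha c alpha *: character R alpha.

Lemma fourier_dual_coef alpha q : dual_of alpha q ->
  fourier a (dual R q) = c alpha / (irrep_dim alpha)%:R.
Proof.
move=> alpha_q; have [_ Z S] := scalar_morph (fourier_scalar (dual R q)).
rewrite fourierC aE S (bigD1 alpha) //= Z fourierC fourier_character alpha_q.
rewrite mul1r big1 ?addr0 // => beta neq_beta.
rewrite Z fourierC fourier_character.
case beta_q: (dual_of beta q); last by rewrite mul0r mulr0.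
by rewrite (dual_of_inj beta_q alpha_q) eqxx in neq_beta.
Qed.

(** This is the invariance needed by [conv_pow_dual]: q and its flip belong to the same alpha. *)
Lemma fourier_dual_flip q : fourier a (dual R (vflip q)) = fourier a (dual R q).
Proof.
have [alpha alpha_q] := dual_of_exists q.
have flip_q : dual_of alpha (vflip q) by rewrite dual_of_flip.
by rewrite (fourier_dual_coef alpha_q) (fourier_dual_coef flip_q).
Qed.

Lemma character_trivial : character R (trivial_irrep n) = 1.
Proof.
rewrite character_Rho /dual /wchar /zchar scale1r; congr pair.
  by apply/ffunP => q; rewrite !ffunE /= !mulr0 !addr0.
apply/matrixP => i j.
by rewrite !mxE mulr0 etaX0 mulr1 add0r addr0 eq_sym.
Qed.

(** As the transform of the unit, the Haar state is evaluated on dual elements by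
    [fourier_character]. *)
Lemma haar_fourier (x : A) : haar x = fourier (character R (trivial_irrep n)) x.
Proof. by rewrite character_trivial /fourier mulr1. Qed.

Lemma trivial_dual_of q : dual_of (trivial_irrep n) q = (q == (0, 0, true)).
Proof. by case: q => -[u v] b; rewrite /= oppr0 !xpair_eqE -andbA. Qed.

Hypothesis a_unital : fourier a 1 = 1.

(** The Haar state vanishes on every dual element except the unit, which is the one for (0, 0,
    [true]); there both terms equal 1. *)
Lemma conv_pow_sub_haar_dual alpha q k : dual_of alpha q ->
  conv_pow (fourier a) k (dual R q) - haar (dual R q)
  = (alpha != trivial_irrep n)%:R * (c alpha / (irrep_dim alpha)%:R) ^+ k.
Proof.
move=> alpha_q.
rewrite (conv_pow_dual (fourier_scalar a) fourier_dual_flip).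
rewrite haar_fourier fourier_character divr1.
have [alpha1|alpha_neq1] := eqVneq alpha (trivial_irrep n); last first.
  case triv_q: (dual_of _ q); last first.
    by rewrite subr0 mul1r (fourier_dual_coef alpha_q).
  by rewrite (dual_of_inj alpha_q triv_q) eqxx in alpha_neq1.
rewrite -alpha1 alpha_q mul0r; move: alpha_q.
rewrite alpha1 trivial_dual_of => /eqP ->.
by rewrite -character_Rho character_trivial a_unital expr1n subrr.
Qed.

Lemma ler_sum_dual (F : irrep n -> C) : (forall alpha, 0 <= F alpha) ->
  forall G : 'Z_n * 'Z_n * bool -> C,
  (forall alpha q, dual_of alpha q -> G q = F alpha) ->
  \sum_q G q <= \sum_alpha (irrep_dim alpha)%:R ^+ 2 * F alpha.
Proof.
move=> F_ge0 G GF.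
(* Exactly one alpha contributes for each q; exchanging the sums then counts the triples of each
   alpha. *)
rewrite (eq_bigr (fun q => \sum_(alpha | dual_of alpha q) F alpha)); last first.
  move=> q _; have [alpha alpha_q] := dual_of_exists q.
  rewrite (GF _ _ alpha_q) (big_pred1 alpha) // => beta.
  apply/idP/eqP => [beta_q|->//]; exact: dual_of_inj beta_q alpha_q.
rewrite (exchange_big_dep predT) //=; apply: ler_sum => alpha _.
rewrite sumr_const -[X in X <= _]mulr_natl ler_wpM2r //.
by rewrite -natrX ler_nat leq_card_dual_of.
Qed.

Lemma conv_pow_bound (p : A) k : projection p ->
  `|conv_pow (fourier a) k p - haar p| ^+ 2
  <= 4^-1 * \sum_(alpha | alpha != trivial_irrep n) (irrep_dim alpha)%:R ^+ 2
       * (`|c alpha| / (irrep_dim alpha)%:R) ^+ (2 * k).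
Proof.
move=> p_proj; pose g x := conv_pow (fourier a) k x - haar x.
have g_lin : scalar g.
  move=> z x y; rewrite /g conv_pow_scalar !haar_fourier fourier_scalar /=.
  by rewrite opprD addrACA -mulrBr.
have g1 : g 1 = 0.
  have := @conv_pow_sub_haar_dual (trivial_irrep n) (0, 0, true) k.
  rewrite trivial_dual_of !eqxx -character_Rho character_trivial => /(_ isT).
  by rewrite mul0r.
apply: le_trans (projection_bound g_lin g1 p_proj) _.
rewrite ler_wpM2l ?invr_ge0 ?ler0n //.
pose F alpha : C := (alpha != trivial_irrep n)%:R
  * (`|c alpha| / (irrep_dim alpha)%:R) ^+ (2 * k).
apply: le_trans (@ler_sum_dual F _ _ _) _.
- by move=> alpha; rewrite mulr_ge0 ?exprn_ge0 ?divr_ge0.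
- move=> alpha q alpha_q; rewrite /g (conv_pow_sub_haar_dual k alpha_q) /F.
  case: (alpha != _); last by rewrite !mul0r normr0 expr0n.
  by rewrite !mul1r normrX -exprM mulnC normrM normfV normr_nat.
rewrite [X in _ <= X]big_mkcond /=; apply: ler_sum => alpha _; rewrite /F.
by case: (alpha != _); rewrite ?mul1r // mul0r mulr0.
Qed.

End Main.
End Bound.

Unset Implicit Arguments.
Set Strict Implicit.

Theorem lemma3p2 (R : realType) (n : nat) (n_ge2 : (2 <= n)%N)
    (c : irrep n -> R[i]) (a : sekine R n)
    (aE : a = \sum_(alpha : irrep n) c alpha *: character R alpha)
    (a_state : state (fourier a)) (k : nat) :
  (qtv_dist (conv_pow (fourier a) k) (@haar R n)
   <= (Num.sqrt
         (4^-1 * (\sum_(alpha : irrep n |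
                     (alpha != trivial_irrep n) && (irrep_dim alpha == 1%N))
                   normc (c alpha) ^+ (2 * k))
          + (4 ^+ k)^-1 * (\sum_(alpha : irrep n | irrep_dim alpha == 2%N)
                            normc (c alpha) ^+ (2 * k))))%:E)%E.
Proof.
(* Writing n as [m.+2] makes ['Z_n] the ordinals below n, the form used in the preceding
   sections. *)
case: n n_ge2 c a aE a_state => [|[|m]] // _ c a aE [_ _ a_unital].
apply: ub_ereal_sup => _ [p p_proj <-]; rewrite lee_fin.
set S := (S in Num.sqrt S).
set z := _ - _.
suff le_zS : normc z ^+ 2 <= S.
  have normc_ge0 : 0 <= normc z by case: z {le_zS} => x y; exact: sqrtr_ge0.
  by rewrite -(ger0_norm normc_ge0) -sqrtr_sqr ler_wsqrtr.
have := conv_pow_bound aE a_unital k p_proj.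
suff -> : 4^-1 * \sum_(alpha | alpha != trivial_irrep m.+2)
    (irrep_dim alpha)%:R ^+ 2 * (`|c alpha| / (irrep_dim alpha)%:R) ^+ (2 * k)
    = (S%:C)%C.
  by rewrite -[`|_|]/((normc _)%:C)%C -rmorphXn lecR.
rewrite (bigID (fun alpha => irrep_dim alpha == 1%N)) /= mulrDr rmorphD /=.
rewrite !rmorphM !rmorph_sum /= !fmorphV rmorphXn /= !rmorph_nat.
congr (_ + _).
  congr (_ * _); apply: eq_bigr => alpha /andP[_ /eqP ->].
  by rewrite expr1n mul1r divr1 rmorphXn.
(* Outside dimension 1, the dimension is 2 and alpha is nontrivial. The factor 1/4 cancels 2^2, and
   2^(2k) = 4^k gives the stated coefficient. *)
rewrite (eq_bigl (fun alpha => irrep_dim alpha == 2)); last first.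
  by case=> [l b|u v|h l b]; rewrite /= ?andbF.
rewrite !mulr_sumr; apply: eq_bigr => alpha /eqP ->.
rewrite expr_div_n [2%:R ^+ (2 * k)]exprM rmorphXn /=.
have -> : 2%:R ^+ 2 = 4%:R :> R[i] by rewrite -natrX.
have four_k : 4%:R ^+ k != 0 :> R[i] by rewrite expf_neq0 ?pnatr_eq0.
by field.
Qed.
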